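(* Let $K$ be a nonempty subset of a metric space $(X,d)$ and let $\{T_{n}\}_{n=1}^{\infty}$ and $f$ be self-maps of $K$ satisfying $T_{1}(K) \subseteq f(K)$. Assume that for all $x, y \in K$ and for all $j \in \mathbb{N}$, \[ d(T_{1}x, T_{j}y) \leq \varphi\Big(\max\big\{d(fx, fy),\, d(T_{1}x, fx),\, d(T_{j}y, fy),\, \tfrac{1}{2}[d(T_{1}x, fy) + d(T_{j}y, fx)]\big\}\Big), \] where $\varphi: \mathbb{R}_{+} \to \mathbb{R}_{+}$ is monotonically increasing and continuous on $\mathbb{R}_{+}$ and $0 \leq \varphi(t) < t$ for $t > 0$. Further assume that either $T_{1}(K)$ or $f(K)$ is complete and that the pair of mappings $(T_{1}, f)$ is weakly compatible. Then $\{T_{n}\}_{n=1}^{\infty}$ and $f$ have a unique common fixed point in $K$; that is, there is a unique $z \in K$ with $fz = z$ and $T_{n}z = z$ for all $n \in \mathbb{N}$.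
   Context: Notation: $\mathbb{R}_{+} = [0,\infty)$; $\mathbb{N}$ is the set of positive integers. Two self-maps $S, h$ of $K$ are called weakly compatible if they commute at their coincidence points: for every $x \in K$, if $hx = Sx$ then $hSx = Shx$. Completeness of a subset of $X$ means completeness with respect to the restricted metric $d$. *)

(* Defs.v *)
From mathcomp Require Import all_boot all_order all_algebra.
From mathcomp Require Import all_classical all_reals.
From mathcomp Require Import topology normedtype.

Set Implicit Arguments.
Unset Strict Implicit.
Unset Printing Implicit Defensive.

Import Order.TTheory GRing.Theory Num.Theory.
Import numFieldNormedType.Exports.

Local Open Scope classical_set_scope.
Local Open Scope ring_scope.

(* Sequential completeness of A for the metric restricted to A: a sequence of
   A is Cauchy (resp. tends to a point of A) for the restricted metric iff it
   is (resp. does) in X, so no separate subspace structure is needed. *)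
Definition complete_subset (R : realType) (X : metricType R) (A : set X) : Prop :=
  forall u : nat -> X, (forall n, A (u n)) -> cauchy (u @ \oo) ->
    exists2 l, A l & u @ \oo --> l.

Definition weakly_compatible (X : Type) (K : set X) (S h : X -> X) : Prop :=
  forall x, K x -> h x = S x -> h (S x) = S (h x).

(* Main.v *)
(* Write S for T_1.  Choosing f x_{n+1} = S x_n, the contraction bounds the
   distances of y_n = S x_n, and consecutive distances decrease.  Continuity of
   phi at t > 0 gives d > 0 with phi (t + d) + d < t; this one margin shows that
   the consecutive distances tend to 0, that y_n stays in the ball of radius t
   around y_N once they are below d, and that f p = S p when f p is the limit.
   Weak compatibility then makes this common value a common fixed point. *)
Require Import Defs.
From mathcomp Require Import all_boot all_order all_algebra.
From mathcomp Require Import all_classical all_reals.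
From mathcomp Require Import topology normedtype.
From mathcomp Require Import lra.

Set Implicit Arguments.
Unset Strict Implicit.
Unset Printing Implicit Defensive.

Import Order.TTheory GRing.Theory Num.Theory.
Import numFieldNormedType.Exports.

Local Open Scope classical_set_scope.
Local Open Scope ring_scope.

Lemma gauge_margin (R : realType) (phi : R -> R) (t : R) :
  {within [set t : R | 0 <= t], continuous phi} ->
  0 < t -> phi t < t -> exists2 d, 0 < d & phi (t + d) + d < t.
Proof.
move=> /subspace_continuousP phiC t0 phit.
have /cvgrPdist_lt/(_ ((t - phi t) / 2)) := phiC t (ltW t0).
have e0 : 0 < (t - phi t) / 2 by lra.
move=> /(_ e0); rewrite near_withinE => /nbhs_ballP[r /= r0 near_t].
(* The gap [t - phi t] is split in two: one half absorbs the variation of [phi] on the ball of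
   radius [r], the other bounds [d]. *)
exists (Num.min (r / 2) ((t - phi t) / 2)); first by rewrite lt_min; lra.
set d := Num.min _ _.
have d_r : d <= r / 2 by rewrite ge_min lexx.
have d_e : d <= (t - phi t) / 2 by rewrite ge_min lexx orbT.
have d0 : 0 < d by rewrite lt_min; lra.
have : `|phi t - phi (t + d)| < (t - phi t) / 2.
  apply: near_t; last by rewrite /=; lra.
  by rewrite /ball /= opprD addNKr normrN gtr0_norm //; lra.
by rewrite ltr_norml; lra.
Qed.

(** The last hypothesis is the contraction at [x_{n+1}], [x_{m+1}], with [f x_{n+1} = y n]. Steps
    cannot increase, and their infimum [r] is 0: otherwise a step below [r + e] would be followed by
    one at most [phi (r + e) < r]. *)
Lemma ciric_sequence_steps_small (R : realType) (X : metricType R)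
    (phi : R -> R) (y : nat -> X) :
  (forall s t, 0 <= s -> s <= t -> phi s <= phi t) ->
  (forall t, 0 < t -> exists2 d, 0 < d & phi (t + d) + d < t) ->
  (forall n m B, mdist (y n) (y m) <= B -> mdist (y n.+1) (y n) <= B ->
     mdist (y m.+1) (y m) <= B ->
     mdist (y n.+1) (y m) + mdist (y m.+1) (y n) <= 2 * B ->
     mdist (y n.+1) (y m.+1) <= phi B) ->
  forall d, 0 < d -> exists N, forall n, (N <= n)%N ->
    mdist (y n.+1) (y n) < d.
Proof.
move=> phi_incr margin contr.
pose s n := mdist (y n.+1) (y n).
have s0 n : 0 <= s n by exact: mdist_ge0.
(* For the indices [n] and [n.+1] one cross distance vanishes and the other is at most
   [s n + s n.+1]. *)
have s_max n : s n.+1 <= phi (Num.max (s n) (s n.+1)).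
  rewrite /s; set B := Num.max _ _.
  have nB : mdist (y n.+1) (y n) <= B by rewrite le_max lexx.
  have SnB : mdist (y n.+2) (y n.+1) <= B by rewrite le_max lexx orbT.
  rewrite metric_sym; apply: contr => //; first by rewrite metric_sym.
  by have := metric_triangle (y n.+2) (y n.+1) (y n); rewrite mdistxx; lra.
have s_step n : s n.+1 <= s n /\ s n.+1 <= phi (s n).
  have := s_max n; case: (leP (s n.+1) (s n)) => // lt_s.
  have sn0 : 0 < s n.+1 by apply: le_lt_trans lt_s.
  have [d d0 phid] := margin _ sn0.
  have : phi (s n.+1) <= phi (s n.+1 + d) by apply: phi_incr => //; lra.
  by lra.
have s_mono N n : (N <= n)%N -> s n <= s N.
  by apply: (homo_leq (r := fun a b : R => b <= a)) => //;
    [exact: ge_trans | move=> k; case: (s_step k)].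
move=> d d0.
suff [N sN] : exists N, s N < d.
  by exists N => n /s_mono; move/le_lt_trans; apply.
have lbs : has_lbound (range s) by exists 0 => _ [n _ <-].
have infs : has_inf (range s) by split => //; exists (s 0%N), 0%N.
have r0 : 0 <= inf (range s).
  by apply: lb_le_inf; [case: infs | move=> _ [n _ <-]].
have [r_gt0|r_le0] := ltP 0 (inf (range s)); last first.
  by have [_ [n _ <-] sn] := inf_adherent d0 infs; exists n; lra.
have [e e0 phie] := margin _ r_gt0.
have [_ [n _ <-] sn] := inf_adherent e0 infs.
have [_ sSn] := s_step n.
have : inf (range s) <= s n.+1 by apply: ge_inf => //; exists n.+1.
have := phi_incr _ _ (s0 n) (ltW sn); lra.
Qed.

(** With [t = eps / 2] and steps below [d], [y m] within [t] of [y N] makes [t + d] an admissible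
    bound for the pair [N], [m]; hence [y m.+1] is within [d + phi (t + d) < t] of [y N]. *)
Lemma ciric_sequence_cauchy (R : realType) (X : metricType R)
    (phi : R -> R) (y : nat -> X) :
  (forall s t, 0 <= s -> s <= t -> phi s <= phi t) ->
  (forall t, 0 < t -> exists2 d, 0 < d & phi (t + d) + d < t) ->
  (forall n m B, mdist (y n) (y m) <= B -> mdist (y n.+1) (y n) <= B ->
     mdist (y m.+1) (y m) <= B ->
     mdist (y n.+1) (y m) + mdist (y m.+1) (y n) <= 2 * B ->
     mdist (y n.+1) (y m.+1) <= phi B) ->
  cauchy (y @ \oo).
Proof.
move=> phi_incr margin contr; apply: cauchy_exP => eps eps0.
have e0 : 0 < eps / 2 by lra.
have [d d0 phid] := margin _ e0.
have [N sN] := ciric_sequence_steps_small phi_incr margin contr d0.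
exists (y N); exists N => // m /= Nm; rewrite ballEmdist /=.
suff : mdist (y N) (y m) <= eps / 2 by lra.
elim: m Nm => [|m IHm]; first by rewrite leqn0 => /eqP ->; rewrite mdistxx; lra.
rewrite leq_eqVlt => /predU1P[->|]; first by rewrite mdistxx; lra.
rewrite ltnS => Nm; have {IHm} ym := IHm Nm.
have sNN := sN N (leqnn N); have sm := sN m Nm.
have tri1 := metric_triangle (y N.+1) (y N) (y m).
have tri2 := metric_triangle (y m.+1) (y m) (y N).
have tri3 := metric_triangle (y N) (y N.+1) (y m.+1).
have symNm := metric_sym (y m) (y N).
have symN := metric_sym (y N.+1) (y N).
have : mdist (y N.+1) (y m.+1) <= phi (eps / 2 + d) by apply: contr; lra.
by lra.
Qed.

Theorem theorem4p5 (R : realType) (X : metricType R) (K : set X)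
  (T : nat -> {fun K >-> K}) (f : {fun K >-> K}) (phi : R -> R)
  (K_nonempty : K !=set0)
  (T1K_sub_fK : T 1%N @` K `<=` f @` K)
  (phi_ge0 : forall t, 0 <= t -> 0 <= phi t)
  (phi_incr : forall s t, 0 <= s -> s <= t -> phi s <= phi t)
  (phi_cont : {within [set t : R | 0 <= t], continuous phi})
  (phi_lt : forall t, 0 < t -> 0 <= phi t < t)
  (contraction : forall x y, K x -> K y -> forall j, (0 < j)%N ->
     mdist (T 1%N x) (T j y) <=
     phi (Num.max (mdist (f x) (f y))
         (Num.max (mdist (T 1%N x) (f x))
         (Num.max (mdist (T j y) (f y))
                  (2^-1 * (mdist (T 1%N x) (f y) + mdist (T j y) (f x)))))))
  (complete_T1K_or_fK :
     complete_subset (T 1%N @` K) \/ complete_subset (f @` K))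
  (T1_f_wcompat : weakly_compatible K (T 1%N) f) :
  exists! z : X, [/\ K z, f z = z & forall n, (0 < n)%N -> T n z = z].
Proof.
set S := T 1%N in T1K_sub_fK contraction complete_T1K_or_fK T1_f_wcompat *.
have S_K x : K x -> K (S x) by exact: funS.
have margin t : 0 < t -> exists2 d, 0 < d & phi (t + d) + d < t.
  by move=> t0; apply: gauge_margin => //; case/andP: (phi_lt t t0).
have gauge_eq a b : mdist a b <= phi (mdist a b) -> a = b.
  move=> dphi; apply/eqP/negP => /negP; rewrite -mdist_gt0 => /phi_lt.
  by lra.
have bound x y j B : K x -> K y -> (0 < j)%N -> mdist (f x) (f y) <= B ->
    mdist (S x) (f x) <= B -> mdist (T j y) (f y) <= B ->
    mdist (S x) (f y) + mdist (T j y) (f x) <= 2 * B ->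
    mdist (S x) (T j y) <= phi B.
  move=> Kx Ky j0 B1 B2 B3 B4; apply: le_trans (contraction x y Kx Ky j j0) _.
  apply: phi_incr; first by rewrite le_max mdist_ge0.
  by rewrite !ge_max B1 B2 B3 /=; lra.
have [x0 Kx0] := K_nonempty.
(* Dependent choice needs a successor at every point of [X]; outside [K] the point itself is a dummy
   one. *)
have next x : {x' | K x -> K x' /\ f x' = S x}.
  apply: cid; have [Kx|nKx] := pselect (K x); last by exists x.
  by have [x' Kx' fx'] := T1K_sub_fK (S x) (imageP S Kx); exists x'.
have [x [x_0 x_next]] := dependent_choice next x0.
have Kx n : K (x n).
  by elim: n => [|n /x_next[]//]; rewrite x_0.
have fx n : f (x n.+1) = S (x n) by have [] := x_next n (Kx n).
pose y n := S (x n).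
have contr n m B : mdist (y n) (y m) <= B -> mdist (y n.+1) (y n) <= B ->
    mdist (y m.+1) (y m) <= B ->
    mdist (y n.+1) (y m) + mdist (y m.+1) (y n) <= 2 * B ->
    mdist (y n.+1) (y m.+1) <= phi B.
  by move=> *; apply: bound => //; rewrite !fx.
have y_cauchy := ciric_sequence_cauchy phi_incr margin contr.
have [p Kp y_fp] : exists2 p, K p & y @ \oo --> f p.
  case: complete_T1K_or_fK => complete_A.
    have [n|l /T1K_sub_fK[p Kp <-] yl] := complete_A y _ y_cauchy; last by exists p.
    exact: imageP.
  have [n|l [p Kp <-] yl] := complete_A y _ y_cauchy; last by exists p.
  by rewrite /y -fx; exact: imageP.
(* If [t = mdist (S p) (f p)] were positive, comparing [p] with [x n.+1] for large [n] would give
   [t <= phi (t + d) + d < t]. *)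
have Sp : S p = f p.
  apply/eqP/negP => /negP; rewrite -mdist_gt0 => t0.
  have [d d0 phid] := margin _ t0.
  have [N sN] := ciric_sequence_steps_small phi_incr margin contr d0.
  have /metricType_numDomainType.cvgrPdist_lt/(_ d d0)[M _ yM] := y_fp.
  pose n := maxn M N.
  have yn : mdist (f p) (y n) < d by apply: yM; exact: leq_maxl.
  have ySn : mdist (f p) (y n.+1) < d.
    by apply: yM; apply: leqW; exact: leq_maxl.
  have sn : mdist (y n.+1) (y n) < d by apply: sN; exact: leq_maxr.
  have tri1 := metric_triangle (S p) (f p) (y n).
  have tri2 := metric_triangle (S p) (y n.+1) (f p).
  have sym := metric_sym (y n.+1) (f p).
  have : mdist (S p) (y n.+1) <= phi (mdist (S p) (f p) + d).
    by apply: bound => //; rewrite ?fx -/S -/(y n) -/(y n.+1); lra.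
  by lra.
pose z := S p.
have Kz : K z by exact: S_K.
have fz : f z = S z by rewrite /z T1_f_wcompat // Sp.
(* Compare [z] with [p]: as [f z = S z] and [f p = S p = z], no term exceeds [mdist (S z) z]. *)
have Sz : S z = z.
  apply: gauge_eq; apply: bound => //; rewrite ?fz -?Sp -/z ?mdistxx ?mdist_ge0 //.
  by have := metric_sym (S z) z; lra.
exists z; split; first split => //; first by rewrite fz.
  (* Taking both arguments equal to [z] leaves only multiples of [mdist z (T j z)]. *)
  move=> j j0; apply/esym/gauge_eq; rewrite -{1}Sz.
  apply: bound => //; rewrite fz Sz ?mdistxx ?mdist_ge0 //;
    rewrite metric_sym //.
  by have := mdist_ge0 z (T j z); have := metric_sym z (T j z); lra.
move=> w [Kw fw Tw]; apply: gauge_eq.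
have Sw : S w = w by exact: Tw.
rewrite -{1}Sz -{1}Sw; apply: bound => //.
- by rewrite fz Sz fw.
- by rewrite fz mdistxx mdist_ge0.
- by rewrite -/S Sw fw mdistxx mdist_ge0.
- by rewrite -/S Sw fz Sz fw; have := metric_sym z w; lra.
Qed.
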